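(* Let $\tau$ be the usual product topology on $\mathbb R\times\mathbb R$, and let $\mu$ be a $\mathcal C$-cross topology on $\mathbb R\times\mathbb R$ such that the family $\mathcal C$ contains a $\pi$-base for $\tau$. If $F\subseteq\mathbb R\times\mathbb R$ is nowhere dense with respect to $\tau$, then $F$ is nowhere dense with respect to $\mu$.
   Context: For $G\subseteq\mathbb R\times\mathbb R$, $G_x=\{y:(x,y)\in G\}$ and $G^y=\{x:(x,y)\in G\}$ denote the vertical and horizontal sections. $\mathcal C$-cross topology on $\mathbb R\times\mathbb R$: let $\mathcal C$ be a family of subsets of $\mathbb R\times\mathbb R$ which is closed under finite intersections and such that for each $G\in\mathcal C$ every non-empty vertical section $G_x$ and every non-empty horizontal section $G^y$ has non-empty interior in $\mathbb R$ (with its usual topology). The $\mathcal C$-cross topology is the topology on $\mathbb R\times\mathbb R$ generated by $\mathcal C$, for which $\mathcal C$ is a base. A $\pi$-base for a topology is a family of non-empty open sets such that every non-empty open set contains a member of the family. *)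

(* Defs.v *)
From HB Require Import structures.
From mathcomp Require Import all_boot all_order all_algebra.
From mathcomp Require Import all_classical all_reals all_analysis.
Import numFieldNormedType.Exports.

Set Implicit Arguments.
Unset Strict Implicit.
Unset Printing Implicit Defensive.

Local Open Scope classical_set_scope.

Definition nowhere_dense (T : topologicalType) (F : set T) : Prop :=
  interior (closure F) = set0.

Definition pi_base (T : topologicalType) (B : set (set T)) : Prop :=
  (forall U, B U -> open U /\ U !=set0) /\
  (forall V, open V -> V !=set0 -> exists2 U, B U & U `<=` V).

(* A copy of [T] whose topology is generated by the family [C]; the copy keeps
   it apart from any topology already inferred on [T]. *)
Definition generated_space (T : Type) (C : set (set T)) : Type := T.

HB.instance Definition _ (T : choiceType) (C : set (set T)) :=
  Choice.on (generated_space C).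

HB.instance Definition _ (T : choiceType) (C : set (set T)) :=
  @isSubBaseTopological.Build (generated_space C) (set T) C id.

(* The last clause says that [C] is a base, and not merely a subbase, of the
   topology it generates; since [setI_closed] only concerns binary
   intersections, this amounts to [C] covering the plane. *)
Definition cross_family (R : realType) (C : set (set (R * R))) : Prop :=
  [/\ setI_closed C,
      forall G x, C G -> xsection G x !=set0 ->
        interior (xsection G x) !=set0,
      forall G y, C G -> ysection G y !=set0 ->
        interior (ysection G y) !=set0 &
      basis (C : set (set (generated_space C)))].

(* Main.v *)
Require Import Defs.
From mathcomp Require Import all_boot all_order all_algebra.
From mathcomp Require Import all_classical all_reals all_analysis.
From mathcomp Require Import lra.
Import numFieldNormedType.Exports.
Local Open Scope classical_set_scope.

(** Let G be a non-empty member of C. A vertical section of G contains an open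
    interval I, and for every y in I the horizontal section of G at y contains
    a rational open interval. By the Baire category theorem a single rational
    interval J serves a set D of ordinates whose closure has interior, so G
    contains J * D and hence meets every non-empty Euclidean-open subset of the
    box J * int (cl D). Since F is nowhere dense, some member V of the
    pi-base lies in that box minus cl F; then V and G meet, and their intersection is a
    non-empty member of C contained in G and missing F. *)

(** Otherwise the complements of the closures are open and dense, and Baire's theorem yields a point
    of [O] outside every [A i]. *)
Lemma countable_cover_somewhere_dense (K : realType)
    (U : completeNormedModType K) (I : countType) (A : I -> set U) (O : set U) :
  open O -> O !=set0 -> O `<=` \bigcup_i A i ->
  exists i, interior (closure (A i)) !=set0.
Proof.
move=> Oo O0 OA; apply: contrapT => /forallNP noA.
(* Baire's theorem takes a sequence, so [I] is enumerated by its codes; a number coding nothing gets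
   the open dense set [setT]. *)
pose H n := if unpickle n is Some i then ~` closure (A i) else setT.
have /Baire Hdense n : open (H n) /\ dense (H n).
  rewrite /H; case: (unpickle n) => [i|]; split.
  - by rewrite openC; exact: closed_closure.
  - move=> V [v Vv] Vo; apply: contrapT => VA; apply: (noA i); exists v.
    apply: (filterS _ (open_nbhs_nbhs (conj Vo Vv))) => z Vz.
    by apply: contrapT => Az; apply: VA; exists z.
  - exact: openT.
  - by move=> V [v Vv] Vo; exists v.
have [y [Oy Hy]] := Hdense O O0 Oo.
have [i _ Aiy] := OA y Oy.
have := Hy (pickle i) Logic.I; rewrite /H pickleK.
by apply; exact: subset_closure.
Qed.

Lemma rational_interval_nbhs (R : realType) (x : R) (S : set R) :
  nbhs x S -> exists2 p : rat * rat,
    (`]ratr p.1, ratr p.2[ : set R) x & `]ratr p.1, ratr p.2[ `<=` S.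
Proof.
move=> /nbhs_ballP[e /= e0 eS].
have [a] := @rat_in_itvoo R (x - e) x ltac:(lra).
have [b] := @rat_in_itvoo R x (x + e) ltac:(lra).
rewrite !in_itv/= => /andP[xb be] /andP[ea ax].
exists (a, b) => /=; first by rewrite in_itv/= ax xb.
move=> z /=; rewrite in_itv/= => /andP[az zb]; apply: eS.
by rewrite /ball/= Num.Theory.ltr_norml; apply/andP; split; lra.
Qed.

Lemma cross_set_contains_dense_box (R : realType) (G : set (R * R)) :
  (forall x, xsection G x !=set0 -> interior (xsection G x) !=set0) ->
  (forall y, ysection G y !=set0 -> interior (ysection G y) !=set0) ->
  G !=set0 ->
  exists J D : set R, [/\ open J, J !=set0, interior (closure D) !=set0 &
    forall x y, J x -> D y -> G (x, y)].
Proof.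
move=> Gx Gy [[x0 y0] G0].
pose J (p : rat * rat) : set R := `]ratr p.1, ratr p.2[.
(* [J p !=set0] excludes empty intervals, which lie in every section. *)
pose D p : set R := [set y | J p !=set0 /\ J p `<=` ysection G y].
have Ix0 : interior (xsection G x0) !=set0.
  by apply: Gx; exists y0; apply/xsectionP.
have ID : interior (xsection G x0) `<=` \bigcup_p D p.
  move=> y /interior_subset /xsectionP Gxy.
  have [|x /rational_interval_nbhs[p px pS]] := Gy y.
    by exists x0; apply/ysectionP.
  by exists p => //; split; [exists x|].
have [p Dp] := @countable_cover_somewhere_dense _ _ _ D _ (open_interior _) Ix0 ID.
have [y [Jp0 _]] : D p !=set0.
  by have [z /interior_subset/(_ setT filterT)[y []]] := Dp; exists y.
exists (J p), (D p); split => //.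
by move=> x z Jx [_ /(_ x Jx) /ysectionP].
Qed.

Theorem theorem5 (R : realType) (C : set (set (R * R)))
  (C_cross : cross_family C)
  (C_pi_base : exists2 B : set (set (R * R)), B `<=` C & pi_base B)
  (F : set (R * R)) (F_nowhere_dense : nowhere_dense F) :
  nowhere_dense (F : set (generated_space C)).
Proof.
have [CI Cx Cy [Copen Cbase]] := C_cross.
have [B BC [Bopen Bpi]] := C_pi_base.
apply/seteqP; split => // q /Cbase[G [CG Gq] GF].
have G0 : G !=set0 by exists q.
have [J [D [Jo [x Jx] [y Dy] JDG]]] :=
  cross_set_contains_dense_box _ G (Cx G ^~ CG) (Cy G ^~ CG) G0.
pose W : set (R * R) := (J `*` interior (closure D)) `&` ~` closure F.
have boxo : open (J `*` interior (closure D)).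
  rewrite openE => -[c d] [/= Jc Dd].
  exists (J, interior (closure D)) => //=.
  by split; [exact: open_nbhs_nbhs|exact: nbhs_interior].
have Wo : open W.
  by apply: openI => //; rewrite openC; exact: closed_closure.
have W0 : W !=set0.
  apply: contrapT => WN0.
  suff : interior (closure F) (x, y) by rewrite F_nowhere_dense.
  have boxxy : nbhs (x, y) (J `*` interior (closure D)) by exact: open_nbhs_nbhs.
  apply: (filterS _ boxxy) => z Jz.
  by apply: contrapT => Fz; apply: WN0; exists z.
have [V BV VW] := Bpi W Wo W0.
have [Vo [[a b] Vab]] := Bopen V BV.
have [[Ja Db] _] := VW _ Vab.
(* The section of [V] at [a] is a neighbourhood of [b], a point of the closure of [D]; moving only
   the ordinate keeps [a] in [J]. *)
have [b' [Db' Vab']] : D `&` xsection V a !=set0.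
  have [[P Q] /= [Pa Qb] PQV] : nbhs (a, b) V by exact: open_nbhs_nbhs.
  apply: (interior_subset Db); apply: filterS Qb => z Qz.
  by apply/xsectionP; apply: PQV; split => //=; exact: nbhs_singleton Pa.
have {}Vab' : V (a, b') by apply/xsectionP.
have Gab' : G (a, b') by exact: JDG.
have CVG : C (V `&` G) by apply: CI => //; exact: BC.
(* As a point of [G], [(a, b')] is in the closure of [F] for the topology generated by [C], so its
   neighbourhood from [C] must meet [F]. *)
have [|f [Ff [Vf _]]] := GF _ Gab' (V `&` G).
  by apply: open_nbhs_nbhs; split => //; exact: Copen.
by have [_] := VW _ Vf; apply; exact: subset_closure.
Qed.
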